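(* Let $c\geq 1$ be a real number and let $a_n=\frac{1}{n^c}$ for integers $n\geq 1$. Let $\mathbb{S}^1=\mathbb{R}/\mathbb{Z}$ with its usual distance $\operatorname{dist}_S$, let $M=\mathbb{S}^1\times(\{a_n : n\geq 1\}\cup\{0\})$ with the distance $\operatorname{dist}((x_1,y_1),(x_2,y_2))=\max\{\operatorname{dist}_S(x_1,x_2),|y_2-y_1|\}$, and let $f\colon M\to M$ be the homeomorphism $f(x,y)=(x+y,y)$ (first coordinate taken modulo $1$). Then the polynomial entropy of $f$ satisfies $$\frac{1}{c+1}\leq h_{pol}(f)\leq\frac{1}{c}.$$
   Context: The usual distance on $\mathbb{R}/\mathbb{Z}$ is $\operatorname{dist}_S(x,y)=\min_{k\in\mathbb{Z}}|x-y+k|$. Polynomial entropy of a homeomorphism $f$ of a compact metric space $(X,\operatorname{dist})$: for $n\geq 1$ and $\varepsilon>0$, a set $E\subset X$ is $(n,\varepsilon)$-spanning for $f$ if for each $y\in X$ there is $x\in E$ with $\operatorname{dist}(f^k(x),f^k(y))\leq\varepsilon$ for all $0\leq k\leq n-1$. Let $r_n(\varepsilon)$ be the minimum cardinality of an $(n,\varepsilon)$-spanning set. Define $h_{pol}^{\varepsilon}(f)=\limsup_{n\to\infty}\frac{\log r_n(\varepsilon)}{\log n}$ and $h_{pol}(f)=\lim_{\varepsilon\to 0}h_{pol}^{\varepsilon}(f)\in[0,\infty]$ (the limit exists by monotonicity in $\varepsilon$). *)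

(* Defs.v *)
From HB Require Import structures.
From mathcomp Require Import all_boot all_order all_algebra.
From mathcomp Require Import generic_quotient ring_quotient finmap.
From mathcomp Require Import mathcomp_extra boolp classical_sets functions cardinality.
From mathcomp Require Import interval_inference reals ereal topology normedtype.
From mathcomp Require Import sequences realfun exp.

Set Implicit Arguments.
Unset Strict Implicit.
Unset Printing Implicit Defensive.

Import Order.TTheory GRing.Theory Num.Theory.
Import numFieldTopology.Exports numFieldNormedType.Exports.

Local Open Scope classical_set_scope.
Local Open Scope ring_scope.
Local Open Scope quotient_scope.

Section polynomial_entropy.
Context {R : realType} {X : metricType R}.
Implicit Types (f : X -> X) (n : nat) (e : R).

Definition spanning f n e (E : set X) :=
  forall y, exists2 x, E x &
    forall k, (k < n)%N -> mdist (iter k f x) (iter k f y) <= e.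

(* The infimum is taken in [\bar R]: it is [+oo] when no finite set is
   spanning, which cannot happen if X is compact and f is continuous. *)
Definition min_spanning f n e : \bar R :=
  ereal_inf [set (#|` E|%:R)%:E | E in [set E : {fset X} |
    spanning f n e [set` E]]].

(* [0^-1 = +oo] in [\bar R], so the terms of index [n <= 1] are meaningless,
   but they do not affect the limsup. *)
Definition hpol_at f e : \bar R :=
  limn_esup (fun n => (lne (min_spanning f n e) / (ln n%:R)%:E)%E).

Definition hpol f : \bar R := lim (hpol_at f e @[e --> 0^'+]).

Lemma min_spanning_ge0 f n e : (0 <= min_spanning f n e)%E.
Proof. by apply: le_ereal_inf_tmp => _ [E _ <-]; rewrite lee_fin. Qed.

Lemma le_min_spanning f n e1 e2 :
  e1 <= e2 -> (min_spanning f n e2 <= min_spanning f n e1)%E.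
Proof.
move=> e12; apply: ereal_inf_le_tmp => _ [E sE <-]; exists E => //= y.
have [x Ex xy] := sE y; exists x => // k kn.
exact: le_trans (xy _ kn) e12.
Qed.

Lemma le_hpol_at f e1 e2 : e1 <= e2 -> (hpol_at f e2 <= hpol_at f e1)%E.
Proof.
move=> e12; apply: le_ereal_inf_tmp => _ [A A_oo <-].
apply: (@le_trans _ _ (ereal_sup
  ((fun n => (lne (min_spanning f n e2) / (ln n%:R)%:E)%E) @` A))).
  by apply: ereal_inf_lbound; exists A.
apply: ge_ereal_sup => _ [n An <-].
apply: (@le_trans _ _ (lne (min_spanning f n e1) / (ln n%:R)%:E)%E); last first.
  by apply: ereal_sup_ubound; exists n.
apply: lee_wpmul2r; last first.
  by rewrite lee_lne ?le_min_spanning// in_itv/= leey andbT min_spanning_ge0.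
rewrite inve_ge0 lee_fin; case: n {An} => [|n]; first by rewrite ln0.
by rewrite ln_ge0// ler1n.
Qed.

Lemma is_cvg_hpol_at f : cvg (hpol_at f e @[e --> 0^'+]).
Proof.
apply: nonincreasing_at_right_is_cvge; near=> e => x y _ _.
exact: le_hpol_at.
Unshelve. all: by end_near. Qed.

End polynomial_entropy.

(* [Num.int_num_subdef] is the predicate underlying [Num.int]: it is the one
   that carries the closure instances. *)
Definition circle (R : realType) : Type :=
  Quotient.quot (Num.int_num_subdef : {pred R}).

Section circle.
Context {R : realType}.
Implicit Types (x y z : circle R) (s t : R).

HB.instance Definition _ := GRing.Zmodule.on (circle R).
HB.instance Definition _ := EqQuotient.on (circle R).

Lemma circle_eqE s t : (s == t %[mod circle R]) = (s - t \is a Num.int).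
Proof. by rewrite piE /= Quotient.equivE. Qed.

Lemma pi_circleD s t :
  \pi_(circle R) (s + t) = \pi_(circle R) s + \pi_(circle R) t.
Proof. by rewrite !piE. Qed.

Definition circle_dist x y : R :=
  inf [set `|repr x - repr y + k%:~R| | k in [set: int]].

Let distZ t : R := inf [set `|t + k%:~R| | k in [set: int]].

Let distZ_le t (k : int) : distZ t <= `|t + k%:~R|.
Proof.
apply: ge_inf; last by exists k.
by exists 0 => _ [m _ <-].
Qed.

Let distZ_attained t : exists k : int, distZ t = `|t + k%:~R|.
Proof.
pose s := t - (Num.floor t)%:~R.
have s0 : 0 <= s by rewrite subr_ge0 floor_le.
have s1 : s <= 1.
  by rewrite lerBlDl; apply/ltW; have := floorD1_gt t; rewrite intrD.
suff [k kP] : exists k : int, forall m : int, `|t + k%:~R| <= `|t + m%:~R|.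
  exists k; apply/eqP; rewrite eq_le distZ_le/=.
  apply: lb_le_inf; first by exists `|t + k%:~R|, k.
  by move=> _ [m _ <-].
have sE (m : int) : t + m%:~R = s + (m + Num.floor t)%:~R.
  by rewrite intrD [m%:~R + _]addrC addrA subrK.
clearbody s.
have ge_s (m : int) : 0 <= m -> s <= `|s + m%:~R|.
  by move=> m0; apply: le_trans (ler_norm _); rewrite lerDl ler0z.
have ge_1s (m : int) : m <= -1 -> 1 - s <= `|s + m%:~R|.
  move=> m1; rewrite -normrN; apply: le_trans (ler_norm _).
  by rewrite opprD [leRHS]addrC lerD2r -intrN ler1z lerNr.
case: (lerP s (1 - s)) => ss.
- exists (- Num.floor t) => m; rewrite sE addNr addr0 ger0_norm//.
  rewrite sE; case: (leP 0 (m + Num.floor t)) => m0; first exact: ge_s.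
  by apply: (le_trans ss); apply: ge_1s; rewrite -ltzD1 addNr.
- exists (- Num.floor t - 1) => m; rewrite sE addrAC addNr add0r.
  rewrite distrC ger0_norm ?subr_ge0// sE.
  case: (leP 0 (m + Num.floor t)) => m0.
    by apply: (le_trans (ltW ss)); exact: ge_s.
  by apply: ge_1s; rewrite -ltzD1 addNr.
Qed.

Let distZ_int t u : t - u \is a Num.int -> distZ t = distZ u.
Proof.
move=> /intrP[m tu]; have -> : t = u + m%:~R by rewrite -tu addrC subrK.
rewrite /distZ; congr inf; apply/seteqP; split => _ [k _ <-].
- by exists (m + k) => //; rewrite intrD addrA.
- by exists (k - m) => //; rewrite intrD intrN addrACA subrr addr0.
Qed.

Lemma circle_dist_pi s t : circle_dist (\pi s) (\pi t) =
  inf [set `|s - t + k%:~R| | k in [set: int]].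
Proof.
apply: distZ_int; rewrite opprD opprK addrACA [- _ + t]addrC.
by rewrite rpredD// -circle_eqE reprK.
Qed.

Lemma circle_dist_le s t (k : int) :
  circle_dist (\pi s) (\pi t) <= `|s - t + k%:~R|.
Proof. by rewrite circle_dist_pi; exact: distZ_le. Qed.

Lemma circle_dist_attained s t :
  exists k : int, circle_dist (\pi s) (\pi t) = `|s - t + k%:~R|.
Proof. by rewrite circle_dist_pi; exact: distZ_attained. Qed.

Let circle_distxx x : circle_dist x x = 0.
Proof.
apply/eqP; rewrite eq_le -[x]reprK; apply/andP; split.
  by have := circle_dist_le (repr x) (repr x) 0; rewrite subrr addr0 normr0.
by have [k ->] := circle_dist_attained (repr x) (repr x).
Qed.

Let circle_dist_positivity x y : circle_dist x y = 0 -> x = y.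
Proof.
rewrite -[x]reprK -[y]reprK.
have [k -> /normr0_eq0 xy] := circle_dist_attained (repr x) (repr y).
apply/eqP; rewrite circle_eqE.
by move: xy => /eqP; rewrite addr_eq0 => /eqP ->; rewrite rpredN intr_int.
Qed.

Let circle_dist_symle x y : circle_dist x y <= circle_dist y x.
Proof.
rewrite -[x]reprK -[y]reprK.
have [k ->] := circle_dist_attained (repr y) (repr x).
rewrite -normrN opprD opprB -intrN; exact: circle_dist_le.
Qed.

Let circle_dist_sym x y : circle_dist x y = circle_dist y x.
Proof. by apply/eqP; rewrite eq_le !circle_dist_symle. Qed.

Let circle_dist_triangle y x z :
  circle_dist x z <= circle_dist x y + circle_dist y z.
Proof.
rewrite -[x]reprK -[y]reprK -[z]reprK.
have [k ->] := circle_dist_attained (repr x) (repr y).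
have [l ->] := circle_dist_attained (repr y) (repr z).
apply: (le_trans (circle_dist_le _ _ (k + l))); apply: le_trans (ler_normD _ _).
by rewrite intrD [in leRHS]addrACA [repr x - _ + (_ - _)]addrA subrK.
Qed.

HB.instance Definition _ := isMetric.Build R (circle R)
  circle_distxx circle_dist_positivity circle_dist_sym circle_dist_triangle.

Lemma circle_distE x y : mdist x y = circle_dist x y.
Proof. by []. Qed.

Lemma le_circle_distD x y s t :
  mdist (x + \pi_(circle R) s) (y + \pi_(circle R) t) <= mdist x y + `|s - t|.
Proof.
rewrite -[x]reprK -[y]reprK -!pi_circleD.
have [k] := circle_dist_attained (repr x) (repr y).
rewrite -circle_distE => ->; apply: (le_trans (circle_dist_le _ _ k)).
by rewrite opprD addrACA [_ + _ + k%:~R]addrAC ler_normD.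
Qed.

End circle.

Section twist.
Context {R : realType}.
Variable c : R.

Definition heights : set R :=
  [set (n%:R `^ c)^-1 | n in [set n : nat | (1 <= n)%N]] `|` [set 0].

Definition cylinder : Type := {p : circle R * R | p.2 \in heights}.
HB.instance Definition _ := Choice.on cylinder.
HB.instance Definition _ := SubType.on cylinder.
Implicit Types p q r : cylinder.

Definition cylinder_dist p q : R :=
  Num.max (mdist (val p).1 (val q).1) `|(val q).2 - (val p).2|.

Let cylinder_distxx p : cylinder_dist p p = 0.
Proof. by rewrite /cylinder_dist mdistxx subrr normr0 maxxx. Qed.

Let cylinder_dist_positivity p q : cylinder_dist p q = 0 -> p = q.
Proof.
move=> pq; have : cylinder_dist p q <= 0 by rewrite pq.
rewrite ge_max normr_le0 subr_eq0 => /andP[xy /eqP yy].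
apply: val_inj; rewrite [LHS]surjective_pairing [RHS]surjective_pairing yy.
congr pair; apply: (@mdist_positivity R).
by apply/eqP; rewrite eq_le xy mdist_ge0.
Qed.

Let cylinder_dist_sym p q : cylinder_dist p q = cylinder_dist q p.
Proof. by rewrite /cylinder_dist metric_sym distrC. Qed.

Let cylinder_dist_triangle q p r :
  cylinder_dist p r <= cylinder_dist p q + cylinder_dist q r.
Proof.
rewrite ge_max; apply/andP; split.
  by rewrite (le_trans (metric_triangle _ (val q).1 _))// lerD// le_max lexx.
rewrite distrC (le_trans (ler_distD (val q).2 _ _))//.
by rewrite lerD// le_max distrC lexx orbT.
Qed.

HB.instance Definition _ := isMetric.Build R cylinder
  cylinder_distxx cylinder_dist_positivity cylinder_dist_sym
  cylinder_dist_triangle.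

Definition twist p : cylinder :=
  exist _ ((val p).1 + \pi_(circle R) (val p).2, (val p).2) (valP p).

Definition twist_inv p : cylinder :=
  exist _ ((val p).1 - \pi_(circle R) (val p).2, (val p).2) (valP p).

End twist.

Arguments twist {R} c p.
Arguments twist_inv {R} c p.

Section twist_homeomorphism.
Context {R : realType}.
Variable c : R.
Implicit Types p q : cylinder c.
Local Notation cylinder := (cylinder c).
Local Notation twist := (twist c).
Local Notation twist_inv := (twist_inv c).

Lemma twistK : cancel twist twist_inv.
Proof. by move=> p; apply: val_inj; case: p => -[x y] yP /=; rewrite addrK. Qed.

Lemma twist_invK : cancel twist_inv twist.
Proof. by move=> p; apply: val_inj; case: p => -[x y] yP /=; rewrite subrK. Qed.

Lemma cylinder_distE p q : mdist p q =
  Num.max (mdist (val p).1 (val q).1) `|(val q).2 - (val p).2|.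
Proof. by []. Qed.

Let lip2_continuous (g : cylinder -> cylinder) :
  (forall p q, mdist (g p) (g q) <= mdist p q *+ 2) -> continuous g.
Proof.
move=> gL p; apply/(@metricType_numDomainType.cvgrPdist_lt _ _ _ (nbhs p)) => e e0.
near=> q; apply: (le_lt_trans (gL p q)); rewrite -mulr_natr -ltr_pdivlMr//.
near: q; rewrite near_simpl -metricType_numDomainType.filter_from_mdist_nbhs.
by exists (e / 2) => //; rewrite divr_gt0.
Unshelve. all: by end_near. Qed.

Let le_cylinder_dist p q (x y : circle R) :
  mdist x y <= mdist (val p).1 (val q).1 + `|(val p).2 - (val q).2| ->
  Num.max (mdist x y) `|(val q).2 - (val p).2| <= mdist p q *+ 2.
Proof.
move=> xy; rewrite ge_max; apply/andP; split.
  rewrite (le_trans xy)// mulr2n lerD// 1?distrC.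
    by rewrite cylinder_distE le_max lexx.
  by rewrite cylinder_distE le_max lexx orbT.
rewrite mulr2n (@le_trans _ _ (mdist p q))// ?lerDl ?mdist_ge0//.
by rewrite cylinder_distE le_max lexx orbT.
Qed.

Lemma continuous_twist : continuous twist.
Proof.
apply: lip2_continuous => p q; rewrite cylinder_distE.
by apply: (@le_cylinder_dist p q); exact: le_circle_distD.
Qed.

Lemma continuous_twist_inv : continuous twist_inv.
Proof.
apply: lip2_continuous => p q; rewrite cylinder_distE; apply: (@le_cylinder_dist p q).
rewrite /= -!raddfN /=; apply: (le_trans (le_circle_distD _ _ _ _)).
by rewrite lerD2l -opprD normrN.
Qed.

End twist_homeomorphism.

Section compact_cylinder.
Context {R : realType}.
Variable c : R.
Hypothesis c0 : 0 < c.

Let heights_ge0 y : heights c y -> 0 <= y.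
Proof. by move=> [[n _ <-]|->//]; rewrite invr_ge0 powR_ge0. Qed.

Let heights_le1 y : heights c y -> y <= 1.
Proof.
move=> [[n /= n1 <-]|->//]; rewrite invf_le1 ?powR_gt0 ?ltr0n//.
by rewrite -[leLHS](powRr0 n%:R) ler_powR ?ler1n// ltW.
Qed.

Let heights_small e : 0 < e ->
  exists N : nat, forall n : nat, (N <= n)%N -> (n%:R `^ c)^-1 < e.
Proof.
move=> e0; pose N := (Num.truncn (e^-1 `^ c^-1)).+1.
exists N => n Nn; have Nt : e^-1 `^ c^-1 < n%:R.
  by rewrite (lt_le_trans (truncnS_gt _))// ler_nat.
rewrite -[ltRHS]invrK ltf_pV2 ?posrE ?invr_gt0 ?powR_gt0//; last first.
  by rewrite (le_lt_trans _ Nt)// powR_ge0.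
have -> : e^-1 = (e^-1 `^ c^-1) `^ c.
  by rewrite -powRrM mulVf ?gt_eqF// powRr1// invr_ge0 ltW.
by rewrite gt0_ltr_powR// nnegrE ?powR_ge0.
Qed.

Let heights_closed : closed (heights c).
Proof.
move=> y cy; apply: contrapT => nhy.
have y0 : 0 < `|y| / 2.
  rewrite divr_gt0// normr_gt0; apply/eqP => yE; apply: nhy.
  by rewrite yE; right.
have [N NP] := heights_small y0.
pose F : set R :=
  (fun n : nat => (n%:R `^ c)^-1) @` [set n | (1 <= n)%N /\ (n < N)%N].
have finF : finite_set F.
  apply: finite_image; apply: (sub_finite_set _ (finite_II N)) => n [].
  by [].
have clF : closed F.
  move: F finF; apply/accessible_finite_set_closed/hausdorff_accessible.
  exact: Rhausdorff.
have nF : nbhs y (~` F).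
  apply: open_nbhs_nbhs; split; first exact: closed_openC.
  by move=> [n [n1 _] ny]; apply: nhy; left; exists n.
have [z [hz [nFz]]] := cy _ (filterI nF (nbhsx_ballx y _ y0)).
rewrite /ball/= => yz.
have z_small : z < `|y| / 2.
  case: hz nFz => [[n n1 <-] nFz|->//]; apply: NP.
  by rewrite leqNgt; apply/negP => nN; apply: nFz; exists n.
have := ler_normD (y - z) z; rewrite subrK leNgt => /negP; apply.
by rewrite [ltRHS]splitr ltrD// ger0_norm// heights_ge0.
Qed.

Let heights_compact : compact (heights c).
Proof.
apply: (subclosed_compact heights_closed (@segment_compact R 0 1)) => y hy /=.
by rewrite in_itv/= heights_ge0// heights_le1.
Qed.

Let cyl0 : cylinder c := exist _ (0, 0) (mem_set (or_intror erefl)).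

Let wrap (ty : R * R) : cylinder c := insubd cyl0 (\pi_(circle R) ty.1, ty.2).

Lemma compact_cylinder : compact [set: cylinder c].
Proof.
have -> : [set: cylinder c] = wrap @` (`[0, 1] `*` heights c).
  apply/seteqP; split => // p _.
  exists (repr (val p).1 - (Num.floor (repr (val p).1))%:~R, (val p).2).
    split => /=; last exact: set_mem (valP p).
    rewrite in_itv/= subr_ge0 floor_le/= lerBlDl ltW//.
    by have := floorD1_gt (repr (val p).1); rewrite intrD.
  apply: val_inj; rewrite /wrap val_insubd/= (valP p).
  rewrite [RHS]surjective_pairing; congr pair.
  rewrite -[RHS]reprK; apply/eqP; rewrite circle_eqE.
  by rewrite addrAC subrr add0r rpredN intr_int.
apply: continuous_compact; last by apply: compact_setX => //; exact: segment_compact.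
apply/subspace_continuousP => -[t y] [/= _ hy].
apply/(@metricType_numDomainType.cvgrPdist_lt _ _ _ (within _ (nbhs (t, y)))) => e e0.
rewrite near_withinE; near=> sz => -[_ /= hz].
rewrite cylinder_distE /wrap !val_insubd/= !mem_set//= gt_max; apply/andP; split.
  have := le_circle_distD 0 0 t sz.1; rewrite !add0r mdistxx add0r.
  move=> /le_lt_trans; apply; near: sz.
  have : nbhs (t, y) (ball (t, y) e) by exact: nbhsx_ballx.
  by apply: filterS => -[a b] [].
rewrite distrC; near: sz.
have : nbhs (t, y) (ball (t, y) e) by exact: nbhsx_ballx.
by apply: filterS => -[a b] [].
Unshelve. all: by end_near. Qed.

End compact_cylinder.

(* Main.v *)
(* Two points at heights [y] and [y'] drift apart horizontally by [k |y - y'|]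
   after [k] steps.
   Upper bound: for time [n], all heights below [e / (2 n)] can be replaced by
   the height [0], and only about [(2 n / e)^(1/c)] heights are above; with a
   fixed finite net of the circle this gives [O(n^(1/c))] centres.
   Lower bound: consecutive heights satisfy [a_m - a_(m+1) >= (m+1)^-(c+1)], so
   among the first [n^(1/(c+1))] heights all gaps are at least [1 / n], and the
   points above [0] at these heights drift apart by a definite amount before
   time [n]; no two of them share a centre. *)
Require Import Defs.
From mathcomp Require Import all_boot all_order all_algebra.
From mathcomp Require Import generic_quotient finmap boolp classical_sets.
From mathcomp Require Import reals ereal topology normedtype sequences exp.
From mathcomp Require Import ring lra.

Import Order.TTheory GRing.Theory Num.Theory.
Import numFieldTopology.Exports numFieldNormedType.Exports.

Local Open Scope quotient_scope.
Local Open Scope classical_set_scope.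
Local Open Scope ring_scope.

(** * From power bounds on spanning numbers to bounds on the entropy *)

Lemma ln_eventually_ge (R : realType) (B : R) :
  \forall n \near \oo, B <= ln n%:R.
Proof.
near=> n; have n_ge : expR B <= n%:R :> R.
  by near: n; exact: nbhs_infty_ger.
by rewrite -[B]expRK ler_ln ?posrE ?(lt_le_trans _ n_ge) ?expR_gt0.
Unshelve. all: by end_near. Qed.

Lemma ln_scaled_powR (R : realType) (D a x : R) : 0 < D -> 0 < x ->
  ln (D * x `^ a) = ln D + a * ln x.
Proof. by move=> D0 x0; rewrite lnM ?posrE ?powR_gt0// ln_powR. Qed.

Lemma lne_div_ln (R : realType) (D a x : R) : 0 < D -> 1 < x ->
  (lne (D * x `^ a)%:E / (ln x)%:E = (a + ln D / ln x)%:E)%E.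
Proof.
move=> D0 x1; have x0 : 0 < x by rewrite (lt_trans _ x1).
have lnx0 : ln x != 0 by rewrite gt_eqF// ln_gt0.
rewrite lne_EFin ?mulr_gt0 ?powR_gt0// ln_scaled_powR// inver (negPf lnx0).
by rewrite -EFinM mulrDl mulfK// addrC.
Qed.

Section growth.
Context {R : realType} {X : metricType R}.
Variables (f : X -> X) (e a D : R).
Hypothesis D0 : 0 < D.

Let u n := (lne (min_spanning f n e) / (ln n%:R)%:E)%E.

Let near_error d : 0 < d ->
  \forall n \near \oo, (1 < n)%N /\ `|ln D / ln n%:R| <= d.
Proof.
move=> d0; near=> n.
have n1 : (1 < n)%N by near: n; exact: nbhs_infty_gt.
have lnn : 0 < ln (n%:R : R) by rewrite ln_gt0// ltr1n.
split=> //; rewrite normrM normfV (gtr0_norm lnn) ler_pdivrMr// mulrC.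
by rewrite -ler_pdivrMr//; near: n; exact: ln_eventually_ge.
Unshelve. all: by end_near. Qed.

(** The constant [D] only adds [ln D / ln n] to the exponent [a], and this error tends to [0]. *)
Lemma hpol_at_le_growth :
  (\forall n \near \oo, min_spanning f n e <= (D * n%:R `^ a)%:E)%E ->
  (hpol_at f e <= a%:E)%E.
Proof.
move=> growth; apply/lee_addgt0Pr => d d0.
have [N _ NP] := filterI growth (near_error d d0).
apply: (@le_trans _ _ (ereal_sup (u @` [set n | (N <= n)%N])%classic)).
  apply: ereal_inf_lbound; exists [set n | (N <= n)%N]%classic => //.
  by exists N.
apply: ge_ereal_sup => _ [n /= Nn <-].
have [ubn [n1 err]] := NP n Nn.
have n0 : 0 < n%:R :> R by rewrite ltr0n (ltn_trans _ n1).
have : (u n <= lne (D * n%:R `^ a)%:E / (ln n%:R)%:E)%E.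
  apply: lee_wpmul2r; first by rewrite inve_ge0 lee_fin ln_ge0// ler1n ltnW.
  rewrite lee_lne// in_itv/= leey andbT ?min_spanning_ge0//.
  by rewrite lee_fin mulr_ge0 ?powR_ge0// ltW.
move=> /le_trans; apply; rewrite lne_div_ln ?ltr1n// -EFinD lee_fin lerD2l.
exact: le_trans (ler_norm _) err.
Qed.

Lemma hpol_at_ge_growth :
  (\forall n \near \oo, (D * n%:R `^ a)%:E <= min_spanning f n e)%E ->
  (a%:E <= hpol_at f e)%E.
Proof.
move=> growth; apply: le_ereal_inf_tmp => _ [A A_oo <-].
apply/lee_addgt0Pr => d d0.
(* [A] is an arbitrary set of the filter; one index [N] of [A] where the growth bound and the small
   error both hold bounds its supremum from below. *)
have [N _ NP] := filterI A_oo (filterI growth (near_error d d0)).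
have [An [lbn [n1 err]]] := NP N (leqnn N).
have n0 : 0 < N%:R :> R by rewrite ltr0n (ltn_trans _ n1).
rewrite -leeBlDr//; apply: (@le_trans _ _ (u N)); last first.
  by apply: ereal_sup_ubound; exists N.
have : (lne (D * N%:R `^ a)%:E / (ln N%:R)%:E <= u N)%E.
  apply: lee_wpmul2r; first by rewrite inve_ge0 lee_fin ln_ge0// ler1n ltnW.
  rewrite lee_lne// in_itv/= leey andbT ?min_spanning_ge0//.
  by rewrite lee_fin mulr_ge0 ?powR_ge0// ltW.
apply: le_trans; rewrite lne_div_ln ?ltr1n// -EFinB lee_fin lerD2l lerNl.
by apply: le_trans err; rewrite -normrN ler_norm.
Qed.

End growth.

(** * Orbits of the twist, with circles indexed by natural numbers *)

Section twist_orbits.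
Context {R : realType}.
Variable c : R.
Implicit Types (x : circle R) (p q : cylinder c) (n m k : nat) (e t : R).

(* [height 0] is the height [0]: [0 `^ c = 0] for [c != 0] and [0^-1 = 0]. *)
Definition height m : R := (m%:R `^ c)^-1.

Lemma height_in m : height m \in heights c.
Proof.
apply: mem_set; case: m => [|m]; last by left; exists m.+1.
rewrite /height; have [->|c0] := eqVneq c 0.
  by left; exists 1%N => //; rewrite !powRr0.
by right; rewrite powR0// invr0.
Qed.

Definition point x m : cylinder c := exist _ (x, height m) (height_in m).

Lemma point_surj p : c != 0 -> exists m, p = point (val p).1 m.
Proof.
move=> c0; have [m pE] : exists m, (val p).2 = height m.
  have [[m _ <-]|->] := set_mem (valP p); first by exists m.
  by exists 0%N; rewrite /height powR0// invr0.
by exists m; apply: val_inj; rewrite /= -pE -surjective_pairing.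
Qed.

Lemma iter_twist k p : val (iter k (twist c) p) =
  ((val p).1 + \pi_(circle R) (k%:R * (val p).2), (val p).2).
Proof.
elim: k => [|k IH].
  rewrite /= mul0r [LHS]surjective_pairing; congr pair.
  by rewrite -[in RHS](reprK (val p).1) -pi_circleD addr0 reprK.
rewrite iterS /twist /= IH/=; congr pair.
by rewrite -addrA -pi_circleD -natr1 mulrDl mul1r.
Qed.

(** The second entry of the maximum is the vertical gap, which the first one misses at [k = 0]. *)
Lemma le_mdist_iter_twist k p q :
  mdist (iter k (twist c) p) (iter k (twist c) q) <=
  Num.max (mdist (val p).1 (val q).1 + k%:R * `|(val p).2 - (val q).2|)
          `|(val p).2 - (val q).2|.
Proof.
rewrite cylinder_distE !iter_twist/= [in leLHS](distrC (val q).2).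
rewrite le_max2 // (le_trans (le_circle_distD _ _ _ _))// lerD2l.
by rewrite -mulrBr normrM normr_nat.
Qed.

(** * Upper bound: spanning grids *)

Lemma circle_net n x : (0 < n)%N ->
  exists2 i, (i < n)%N & mdist (\pi_(circle R) (i%:R / n%:R)) x <= n%:R^-1.
Proof.
move=> n0; have n0' : 0 < n%:R :> R by rewrite ltr0n.
pose s := repr x - (Num.floor (repr x))%:~R.
have s0 : 0 <= s by rewrite subr_ge0 floor_le.
have s1 : s < 1 by rewrite ltrBlDl; have := floorD1_gt (repr x); rewrite intrD.
have sn0 : 0 <= s * n%:R by rewrite mulr_ge0// ltW.
exists (Num.truncn (s * n%:R)).
  by rewrite truncn_lt_nat// gtr_pMl.
rewrite -[x in leLHS]reprK.
apply: (le_trans (circle_dist_le _ _ (Num.floor (repr x)))).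
have -> (z : R) : z - repr x + (Num.floor (repr x))%:~R = z - s.
  by rewrite /s; lra.
have /andP[lb ub] := truncn_itv sn0; rewrite -natr1 in ub.
rewrite ler_norml; apply/andP; split.
  rewrite -(ler_pM2r n0') mulNr mulVf ?gt_eqF// mulrBl divfK ?gt_eqF//; lra.
rewrite -(ler_pM2r n0') mulVf ?gt_eqF// mulrBl divfK ?gt_eqF//; lra.
Qed.

(* The grid of the points [(i / K, height m)], [i < K], [m < M], is spanning:
   orbits at heights beyond the [M]-th are shadowed by fixed points. *)
Lemma min_spanning_twist_grid n e (K M : nat) :
  (0 < n)%N -> 0 < e -> c != 0 -> (0 < K)%N -> (0 < M)%N -> 2 / e <= K%:R ->
  (forall m, (M <= m)%N -> n%:R * height m <= e / 2) ->
  (min_spanning (twist c) n e <= (K * M)%:R%:E)%E.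
Proof.
move=> n0 e0 c0 K0 M0 Ke Mtail.
have K0' : 0 < K%:R :> R by rewrite ltr0n.
pose s := [seq point (\pi_(circle R) (i%:R / K%:R)) m
             | i <- iota 0 K, m <- iota 0 M].
apply: (@le_trans _ _ (#|` seq_fset tt s|%:R%:E)); last first.
  rewrite lee_fin ler_nat size_seq_fset (leq_trans (size_undup _))//.
  by rewrite size_allpairs !size_iota.
apply: ereal_inf_lbound; exists (seq_fset tt s) => // y.
have [m ->] := point_surj y c0; set x := (val y).1.
have [i iK ix] := circle_net K x K0.
have hK : K%:R^-1 <= e / 2.
  by rewrite -[leRHS]invrK invf_div lef_pV2 ?posrE// divr_gt0.
(* Low circles are sent to index [0], that is, to height [0]; [0 < M] keeps this index in the
   grid. *)
pose m' := if (m < M)%N then m else 0%N.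
have drift k : (k <= n)%N -> k%:R * `|height m' - height m| <= e / 2.
  rewrite /m'; case: ltnP => mM kn.
    by rewrite subrr normr0 mulr0 divr_ge0// ltW.
  rewrite {1}/height powR0// invr0 sub0r normrN ger0_norm ?invr_ge0 ?powR_ge0//.
  apply: le_trans (Mtail _ mM); rewrite ler_wpM2r ?ler_nat//.
  by rewrite invr_ge0 powR_ge0.
exists (point (\pi_(circle R) (i%:R / K%:R)) m').
  apply: etrans (seq_fsetE tt s _) _; apply/allpairsP.
  exists (i, m'); split => //.
    by rewrite mem_iota.
  by rewrite mem_iota /m'; case: ltnP.
move=> k kn; apply: (le_trans (le_mdist_iter_twist _ _ _)) => /=.
(* At [k = 1] the drift is the vertical gap itself. *)
have := drift 1%N n0; rewrite mul1r => d1.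
have := drift k (ltnW kn) => dk.
rewrite ge_max; apply/andP; split; rewrite [leRHS]splitr.
  by rewrite lerD// (le_trans ix).
by rewrite (le_trans d1)// lerDl divr_ge0// ltW.
Qed.

Lemma min_spanning_twist_le e : 0 < e -> 0 < c ->
  exists2 D, 0 < D & forall n, (0 < n)%N ->
    (min_spanning (twist c) n e <= (D * n%:R `^ c^-1)%:E)%E.
Proof.
move=> e0 c0; pose K := (Num.truncn (2 / e)).+1.
have e2 : 0 < 2 / e by rewrite divr_gt0.
exists (K%:R * ((2 / e) `^ c^-1 + 1)).
  by rewrite mulr_gt0 ?ltr0n// ltr_wpDl ?powR_ge0.
move=> n n0; have n0' : 0 < n%:R :> R by rewrite ltr0n.
(* [t] solves [n * t^(-c) = e / 2], so indices from [t] on satisfy the tail condition of the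
   grid. *)
pose t := (2 / e * n%:R) `^ c^-1.
have t0 : 0 <= t by rewrite powR_ge0.
apply: (@le_trans _ _ (K * (Num.truncn t).+1)%:R%:E).
  apply: min_spanning_twist_grid => //; first by rewrite gt_eqF.
    by rewrite ltW// truncnS_gt.
  move=> m tm; have {}tm : t <= m%:R.
    by rewrite (le_trans (ltW (truncnS_gt _)))// ler_nat.
  have en0 : 0 < 2 / e * n%:R by rewrite mulr_gt0.
  have mc : 2 / e * n%:R <= m%:R `^ c.
    have -> : 2 / e * n%:R = t `^ c.
      rewrite /t -powRrM mulVf ?gt_eqF// powRr1//; exact: (ltW en0).
    by apply: ge0_ler_powR; rewrite ?nnegrE// ltW.
  rewrite /height ler_pdivrMr; last exact: lt_le_trans mc.
  rewrite -ler_pdivrMl ?divr_gt0// invf_div; exact: mc.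
(* The number of heights is at most [t + 1], and this [1] is absorbed using [1 <= n^(1/c)]. *)
rewrite lee_fin natrM -mulrA ler_wpM2l// -natr1 mulrDl mul1r.
rewrite -powRM ?(ltW e2)// -/t lerD ?truncn_le//.
by rewrite -[leLHS](powRr0 n%:R) ler_powR ?ler1n// invr_ge0 ltW.
Qed.


(** * Lower bound: separated orbits *)

Lemma ge_circle_dist s t : 0 <= s - t <= 1 / 2 ->
  s - t <= mdist (\pi_(circle R) s) (\pi_(circle R) t).
Proof.
move=> /andP[st0 st2]; have [k] := circle_dist_attained s t.
rewrite -circle_distE => ->.
have [k0|k1] := leP 0 k.
  by rewrite (le_trans _ (ler_norm _))// lerDl ler0z.
(* A negative translate has length at least [1 - (s - t)], hence at least [1 / 2]. *)
have {}k1 : k%:~R <= -1 :> R by rewrite -(mulrN1z 1) ler_int -ltzD1 addNr.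
rewrite -normrN (le_trans _ (ler_norm _))//; lra.
Qed.

Lemma twist_separates n d p q : (val p).1 = (val q).1 ->
  (1 < n)%N -> 0 <= d <= 1 / 4 -> 1 <= n%:R * ((val p).2 - (val q).2) ->
  exists2 k, (k < n)%N & d < mdist (iter k (twist c) p) (iter k (twist c) q).
Proof.
move=> pq1 n1 /andP[d0 d4] ng; set g := _ - _ in ng.
have n0 : 0 < n%:R :> R by rewrite ltr0n ltnW.
have g0 : 0 < g by rewrite -(pmulr_rgt0 _ n0) (lt_le_trans _ ng).
have [dg|gd] := ltP d g.
  exists 0%N; first exact: ltnW.
  rewrite cylinder_distE /= distrC gtr0_norm ?lt_max ?dg ?orbT//.
(* At the first time [k] at which the horizontal drift [k * g] exceeds [d], it
   is at most [2 * d <= 1 / 2], so it does not wrap around the circle. *)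
pose k := (Num.truncn (d / g)).+1.
have dg0 : 0 <= d / g by rewrite divr_ge0// ltW.
have /andP[] := truncn_itv dg0.
rewrite ltr_pdivrMr// ler_pdivlMr// => lb ub.
have kg : k%:R * g <= 1 / 2 by rewrite /k -natr1 mulrDl mul1r; lra.
exists k.
  (* As [d <= 1 / 4 <= n * g / 4], [k] is at most [n / 4 + 1], which is below [n] once [n >= 2]. *)
  have tn : (Num.truncn (d / g))%:R <= n%:R / 4 :> R.
    by rewrite -(ler_pM2r g0); lra.
  have n2 : 2 <= n%:R :> R by rewrite ler_nat.
  by rewrite -(ltr_nat R) /k -natr1; lra.
have shift : k%:R * g = repr (val p).1 + k%:R * (val p).2 -
    (repr (val p).1 + k%:R * (val q).2).
  by rewrite opprD addrACA subrr add0r -mulrBr.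
have kg0 : 0 <= k%:R * g by rewrite mulr_ge0// ltW.
rewrite cylinder_distE lt_max !iter_twist -pq1/= -[(val p).1]reprK.
rewrite -!pi_circleD (lt_le_trans ub)// shift ge_circle_dist//.
by rewrite -shift kg0.
Qed.

(** With [x = m + 1], write [x^c = x * x^(c - 1)]. Since [c >= 1], raising the factor [x^(c - 1)] to
    [(x + 1)^(c - 1)] only shrinks the gap, and [1 / x - 1 / (x + 1) >= 1 / (x + 1)^2] remains. *)
Lemma height_gap m : 1 <= c ->
  (m.+2%:R `^ (c + 1))^-1 <= height m.+1 - height m.+2.
Proof.
move=> c1; have powE (x : R) : 0 < x -> x `^ c = x * x `^ (c - 1).
  move=> x0; rewrite -[X in X * _]powRr1 ?ltW// -powRD; last first.
    by rewrite (gt_eqF x0) implybT.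
  by congr (_ `^ _); lra.
rewrite /height !powE ?ltr0n//.
rewrite powRD ?pnatr_eq0 ?implybT// powRr1// powE ?ltr0n//.
set x := m.+1%:R; have -> : m.+2%:R = x + 1 by rewrite natr1.
have x0 : 0 < x by rewrite ltr0n.
set a := x `^ _; set b := (x + 1) `^ _.
have a0 : 0 < a by rewrite powR_gt0.
have ab : a <= b.
  by apply: ge0_ler_powR; rewrite ?nnegrE; lra.
have b0 : 0 < b by apply: lt_le_trans ab.
apply: (@le_trans _ _ ((x * b)^-1 - ((x + 1) * b)^-1)); last first.
  by rewrite lerD2r lef_pV2 ?posrE ?mulr_gt0// ler_pM2l.
have -> : (x * b)^-1 - ((x + 1) * b)^-1 = ((x + 1) * b * x)^-1.
  by field; rewrite !gt_eqF// ltr_pwDl.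
rewrite lef_pV2 ?posrE ?mulr_gt0 ?addr_gt0//.
rewrite ler_pM2l ?mulr_gt0 ?addr_gt0//; lra.
Qed.

Lemma le_height i j : 0 <= c -> (0 < i)%N -> (i <= j)%N -> height j <= height i.
Proof.
move=> c0 i0 ij; have j0 := leq_trans i0 ij.
rewrite lef_pV2 ?posrE ?powR_gt0 ?ltr0n//.
by apply: ge0_ler_powR; rewrite ?nnegrE ?ler_nat.
Qed.

Lemma min_spanning_twist_ge n e : 1 <= c -> (1 < n)%N -> 0 < e <= 1 / 8 ->
  ((2^-1 * n%:R `^ (c + 1)^-1)%:E <= min_spanning (twist c) n e)%E.
Proof.
move=> c1 n1 /andP[e0 e8]; apply: le_ereal_inf_tmp => _ [E sE <-].
have n0 : (0 < n)%N by exact: ltnW.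
rewrite lee_fin; set t := n%:R `^ _; pose N := Num.truncn t.
have c1_gt0 : 0 < c + 1 by rewrite ltr_wpDl// (le_trans _ c1).
have t1 : 1 <= t.
  by rewrite -[leLHS](powRr0 n%:R) ler_powR ?ler1n 1?ltnW// invr_ge0 ltW.
have /andP[Nt tN] := truncn_itv (le_trans ler01 t1).
have N1 : 1 <= N%:R :> R by rewrite ler1n truncn_gt0.
(* The factor [2^-1] pays for truncation: [t < N + 1 <= 2 * N]. *)
suff NE : N%:R <= #|` E|%:R :> R.
  by apply: le_trans NE; move: tN; rewrite -/N -natr1; lra.
have gap i j : (0 < i)%N -> (i < j)%N -> (j <= N)%N ->
    1 <= n%:R * (height i - height j).
  case: j => // -[|j] i0; first by rewrite ltnS leqNgt i0.
  rewrite ltnS => ij jN.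
  rewrite -ler_pdivrMl ?ltr0n// mulr1.
  (* The gap contains the one just above the lower height, which is at least
     [N^-(c + 1) >= 1 / n]. *)
  apply: (@le_trans _ _ (height j.+1 - height j.+2)); last first.
    by rewrite lerD2r le_height// (le_trans ler01).
  apply: le_trans (height_gap _ c1).
  have -> : n%:R = t `^ (c + 1).
    by rewrite /t -powRrM mulVf ?gt_eqF// powRr1.
  rewrite lef_pV2 ?posrE ?powR_gt0 ?ltr0n ?(lt_le_trans ltr01)//.
  apply: ge0_ler_powR; rewrite ?nnegrE//; [exact: ltW|exact: le_trans t1|].
  by apply: le_trans Nt; rewrite ler_nat.
have center m : {x | x \in E & forall k, (k < n)%N ->
    mdist (iter k (twist c) x) (iter k (twist c) (point 0 m)) <= e}.
  by apply: cid2; have [x Ex xP] := sE (point 0 m); exists x.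
pose g m := s2val (center m).
have g_neq : forall i j, (0 < i)%N -> (i < j)%N -> (j <= N)%N ->
    g i != g j.
  move=> i j i0 ij jN; apply/eqP => gij.
  (* Orbits sharing a centre stay within [2 * e]; [e <= 1 / 8] puts this within the range of
     [twist_separates]. *)
  have e2 : 0 <= e *+ 2 <= 1 / 4 by rewrite mulr2n; apply/andP; split; lra.
  have [k kn] := @twist_separates n (e *+ 2) (point 0 i) (point 0 j)
    erefl n1 e2 (gap _ _ i0 ij jN).
  apply/negP; rewrite -leNgt mulr2n.
  apply: (le_trans (metric_triangle _ (iter k (twist c) (g i)) _)).
  rewrite lerD//; first by rewrite metric_sym (s2valP' (center i)).
  by rewrite gij (s2valP' (center j)).
rewrite ler_nat -[N in leqLHS](size_iota 1) -(size_map g).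
apply: uniq_leq_size.
  rewrite map_inj_in_uniq ?iota_uniq// => i j.
  rewrite !mem_iota !add1n !ltnS => /andP[i0 iN] /andP[j0 jN] gij.
  apply/eqP; rewrite eqn_leq; apply/andP; split; rewrite leqNgt; apply/negP.
    by move=> ji; have := g_neq j i j0 ji iN; rewrite gij eqxx.
  by move=> ij; have := g_neq i j i0 ij jN; rewrite gij eqxx.
by move=> _ /mapP[m _ ->]; exact: (s2valP (center m)).
Qed.

End twist_orbits.

Theorem proposition3p5 (R : realType) (c : R) (hc : 1 <= c) :
  ((1 / (c + 1))%R%:E <= hpol (twist c))%E /\
  (hpol (twist c) <= (1 / c)%R%:E)%E.
Proof.
have c0 : 0 < c by rewrite (lt_le_trans ltr01).
rewrite !div1r; split.
  apply: lime_ge; first exact: is_cvg_hpol_at.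
  near=> e; apply: (@hpol_at_ge_growth _ _ _ _ _ 2^-1).
    by rewrite invr_gt0.
  near=> n; apply: min_spanning_twist_ge => //.
    by near: n; exact: nbhs_infty_gt.
  by apply/andP; split; near: e; [exact: nbhs_right_gt|apply: nbhs_right_le].
apply: lime_le; first exact: is_cvg_hpol_at.
near=> e; have e0 : 0 < e by near: e; exact: nbhs_right_gt.
(* [D] depends on [e], but the exponent does not, so the bound survives the limit in [e]. *)
have [D D0 DP] := min_spanning_twist_le c e e0 c0.
apply: (@hpol_at_le_growth _ _ _ _ _ D D0).
by near=> n; apply: DP; near: n; exact: nbhs_infty_gt.
Unshelve. all: by end_near. Qed.
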